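(* There is an absolute constant $C$ such that for every integer $k\ge 1$ and every $G\in\{CC_k,CC_k^-\}$, $G$ has a maximum cut $S$ with the following properties: its blocks, in increasing order of row index, follow the pattern $([S],[\bar S-S],[\bar S],[S-\bar S])$ with block lengths $x,y,z,t$ respectively (i.e. the first $x$ rows have type $S\times S$, the next $y$ rows type $\bar S\times S$, the next $z$ rows type $\bar S\times\bar S$, and the last $t$ rows type $S\times\bar S$), where $(x,y,z,t)=\left(\tfrac{k}{3},\tfrac{k}{3},\tfrac{k}{3},0\right)+(\delta_x,\delta_y,\delta_z,0)$ with $|\delta_x|,|\delta_y|,|\delta_z|\le 1$; and the cut size satisfies $\left|cs(S)-\tfrac{5}{6}k^2\right|\le Ck$ (i.e. $cs(S)=\tfrac56 k^2+O(k)$).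
   Context: For an integer $k\ge 0$, $CC_k$ is the graph with vertex set $K\cup K'$, where $K=\{v_0,\dots,v_k\}$ and $K'=\{v'_0,\dots,v'_k\}$, $K$ and $K'$ are cliques, and $v_i$ is adjacent to $v'_j$ if and only if $j<i$; there are no other edges. $CC_k^-$ is $CC_k$ with the vertex $v'_k$ removed. These graphs are exactly the twin-free co-bipartite chain graphs. For $G\in\{CC_k,CC_k^-\}$, row $i$ of $G$ is the pair $(v_i,v'_i)$ whenever both vertices belong to $G$ (rows $0,\dots,k$ for $CC_k$, rows $0,\dots,k-1$ for $CC_k^-$). A cut of $G$ is a subset $S\subseteq V(G)$, $\bar S=V(G)\setminus S$; its cut size $cs(S)$ is the number of edges with exactly one endpoint in $S$, and a maximum cut is one of maximum cut size. With respect to $S$, each row $i$ has a type $S\times S$, $\bar S\times \bar S$, $S\times\bar S$ or $\bar S\times S$, the first coordinate indicating the side of $v_i$ and the second that of $v'_i$. A block is a maximal sequence of consecutive rows of the same type; blocks of type $S\times S$, $\bar S\times\bar S$, $S\times\bar S$, $\bar S\times S$ are denoted $[S]$, $[\bar S]$, $[S-\bar S]$, $[\bar S-S]$; the length of a block is its number of rows (an empty block has length $0$). *)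

(* Defs.v *)
From mathcomp Require Import all_boot all_order all_algebra.
Set Implicit Arguments.
Unset Strict Implicit.
Unset Printing Implicit Defensive.

(* Finite simple graphs whose vertex set is a subset of a fixed finite type,
   so that a graph and its vertex-deleted subgraphs share vertex names. *)
Record sgraph (T : finType) := SGraph {
  vertices : {set T};
  adj : rel T;
  adj_sym : symmetric adj;
  adj_irrefl : irreflexive adj;
  adj_vertices : forall u w, adj u w -> u \in vertices
}.

Section Graph.
Variables (T : finType) (G : sgraph T).

Definition edges : {set {set T}} :=
  [set [set p.1; p.2] | p : T * T & adj G p.1 p.2].

Definition is_cut (S : {set T}) : bool := S \subset vertices G.

Definition cs (S : {set T}) : nat := #|[set e in edges | #|e :&: S| == 1]|.

Definition is_max_cut (S : {set T}) : Prop :=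
  is_cut S /\ forall S' : {set T}, is_cut S' -> cs S' <= cs S.

Variable x : T.

Definition del_adj : rel T := fun u w => [&& adj G u w, u != x & w != x].

Lemma del_adj_sym : symmetric del_adj.
Proof.
by move=> u w; rewrite /del_adj adj_sym; case: (adj G w u); rewrite //= andbC.
Qed.

Lemma del_adj_irrefl : irreflexive del_adj.
Proof. by move=> u; rewrite /del_adj adj_irrefl. Qed.

Lemma del_adj_vertices u w : del_adj u w -> u \in vertices G :\ x.
Proof. by case/and3P=> /adj_vertices uG ux _; rewrite !inE ux. Qed.

Definition del_vertex : sgraph T :=
  SGraph del_adj_sym del_adj_irrefl del_adj_vertices.

End Graph.

Definition cc_vertex (k : nat) : finType := ('I_k.+1 + 'I_k.+1)%type.

Definition v k (i : 'I_k.+1) : cc_vertex k := inl i.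
Definition v' k (j : 'I_k.+1) : cc_vertex k := inr j.

Definition cc_adj k : rel (cc_vertex k) := fun a b =>
  match a, b with
  | inl i, inl j => i != j
  | inr i, inr j => i != j
  | inl i, inr j => j < i
  | inr j, inl i => j < i
  end.

Lemma cc_adj_sym k : symmetric (@cc_adj k).
Proof. by move=> [i|i] [j|j] //=; rewrite eq_sym. Qed.

Lemma cc_adj_irrefl k : irreflexive (@cc_adj k).
Proof. by move=> [i|i] /=; rewrite eqxx. Qed.

Lemma cc_adj_vertices k (a b : cc_vertex k) :
  cc_adj a b -> a \in [set: cc_vertex k].
Proof. by rewrite inE. Qed.

Definition CC (k : nat) : sgraph (cc_vertex k) :=
  SGraph (@cc_adj_sym k) (@cc_adj_irrefl k) (@cc_adj_vertices k).

Definition CC_minus (k : nat) : sgraph (cc_vertex k) :=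
  del_vertex (CC k) (v' ord_max).

Section Rows.
Variables (k : nat) (G : sgraph (cc_vertex k)) (S : {set cc_vertex k}).

(* Indices of the rows of G, in increasing order. *)
Definition rows : seq 'I_k.+1 :=
  [seq i <- enum 'I_k.+1 | (v i \in vertices G) && (v' i \in vertices G)].

(* [true] is the side S, [false] its complement. *)
Definition row_type (i : 'I_k.+1) : bool * bool := (v i \in S, v' i \in S).

(* The four types are pairwise distinct, so the nonempty segments below are
   maximal, i.e. they are exactly the blocks of S. *)
Definition block_pattern (x y z t : nat) : Prop :=
  [seq row_type i | i <- rows] =
    nseq x (true, true) ++ nseq y (false, true) ++
    nseq z (false, false) ++ nseq t (true, false).

End Rows.

(* Main.v *)
(* Read the rows as unit steps of a lattice walk, SS = +P, TS = +Q, TT = -P,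
   ST = -Q with T the complement of S.  If x, y, z, t rows have these types,
   m = x + y + z + t, and D is twice the signed area between the walk and its chord,
   then the cut size c of the first m rows satisfies
     4 c = 3 m^2 - m + 2 D + (x + z) - (y + t) - 3 (x - z)^2 - (y - t)^2.
   Adding rows one at a time gives D <= (x + z)(y + t) - 2 min(x, z) min(y, t).
   For x = z + p and y = t + q (the other cases are symmetric) completing squares
   yields
     4 c <= 3 m^2 - 2 m + 2 x (m + 2) - 3 x^2 - (q - z)^2 - 2 p^2 - 2 p.
   In CC_k^- the extra vertex v_k adds at most m + p edges to the cut.  For each
   residue of m modulo 3 this integer quadratic problem has an optimum with
   x, y, z close to m / 3 and t = 0, at which D attains its bound. *)
Require Import Defs.
From mathcomp Require Import all_boot all_order all_algebra.
From mathcomp Require Import zify ring lra.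
Import Order.TTheory GRing.Theory Num.Theory.
Set Implicit Arguments.
Unset Strict Implicit.
Unset Printing Implicit Defensive.

(** * Cut sizes of lists of row types *)

Local Notation rtype := (bool * bool)%type.
(* [T] stands for the complement of [S]. *)
Local Notation rSS := (true, true).
Local Notation rTS := (false, true).
Local Notation rTT := (false, false).
Local Notation rST := (true, false).

(* Lists of row types are in decreasing order of index: consing appends a row
   after all the others. *)
Fixpoint chain_cut (l : seq rtype) : nat :=
  if l is r :: l' then (chain_cut l' + count (fun q => q.2 != r.1) l')%N else 0%N.

Definition clique_cut (p : pred rtype) (l : seq rtype) : nat :=
  (count p l * count (predC p) l)%N.

Definition row_cut (l : seq rtype) : nat :=
  (clique_cut fst l + clique_cut snd l + chain_cut l)%N.

(** [r] is the row of the lone vertex $v_k$: its second component enters neither the second clique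
    nor the chain part. *)
Definition row_cut_minus (r : rtype) (l : seq rtype) : nat :=
  (clique_cut fst (r :: l) + clique_cut snd l + chain_cut (r :: l))%N.

(** * Signed area and the upper bound on the cut size *)

Lemma count_row (p : pred rtype) (l : seq rtype) :
  count p l = (p rSS * count_mem rSS l
    + p rTS * count_mem rTS l
    + p rTT * count_mem rTT l
    + p rST * count_mem rST l)%N.
Proof.
elim: l => [|r l IH]; first by rewrite /= !muln0.
rewrite /= IH; move: r => [] [] [] /=; lia.
Qed.

(* The quantity D of the header. *)
Fixpoint walk_area (l : seq rtype) : int :=
  if l is r :: l' then
    (walk_area l' +
     match r with
     | rSS => (count_mem rST l')%:Z - (count_mem rTS l')%:Z
     | rTS => (count_mem rSS l')%:Z - (count_mem rTT l')%:Z
     | rTT => (count_mem rTS l')%:Z - (count_mem rST l')%:Z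
     | rST => (count_mem rTT l')%:Z - (count_mem rSS l')%:Z
     end)%R
  else 0%R.

(** All counts being linear in the four multiplicities, appending a row changes both sides by the
    same amount; the order of the rows enters only through [walk_area]. *)
Lemma row_cutE (l : seq rtype) :
  let x := count_mem rSS l in let y := count_mem rTS l in
  let z := count_mem rTT l in let t := count_mem rST l in
  ((4 * row_cut l)%:Z =
   3 * (x + y + z + t)%:Z ^+ 2 - (x + y + z + t)%:Z + 2 * walk_area l
   + (x + z)%:Z - (y + t)%:Z
   - 3 * (x%:Z - z%:Z) ^+ 2 - (y%:Z - t%:Z) ^+ 2)%R.
Proof.
elim: l => [|[a b] l IH] //.
move: IH; rewrite /row_cut /clique_cut /=.
move: (chain_cut l) (walk_area l) (count_row^~ l).
move: (count_mem rSS l) (count_mem rTS l) (count_mem rTT l) (count_mem rST l).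
move=> x y z t c D countE; rewrite !countE.
by case: a; case: b => /= IH; lia.
Qed.

(** A new SS row adds t - y to the area, and adds to the bound |y - t| if x < z and y + t otherwise;
    the other types are alike. *)
Lemma walk_area_le (l : seq rtype) :
  let x := count_mem rSS l in let y := count_mem rTS l in
  let z := count_mem rTT l in let t := count_mem rST l in
  (walk_area l <= ((x + z) * (y + t))%:Z - (2 * minn x z * minn y t)%:Z)%R.
Proof.
elim: l => [|[a b] l IH] //.
move: IH => /=.
move: (walk_area l).
move: (count_mem rSS l) (count_mem rTS l) (count_mem rTT l) (count_mem rST l).
move=> x y z t D IH.
have minSn u w : minn (1 + u) w = (minn u w + (u < w)%N)%N by lia.
have minnS u w : minn u (1 + w) = (minn u w + (w < u)%N)%N by lia.
case: a; case: b => /=; rewrite ?add0n ?minSn ?minnS;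
  move: IH (geq_minl x z) (geq_minr x z) (geq_minl y t) (geq_minr y t);
  move: (minn x z) (minn y t) => mx my;
  case: ltnP; lia.
Qed.

(* Here [z], [p], [t], [q] are minimum and difference of the numbers of SS and TT rows,
   respectively of TS and ST rows. *)
Lemma row_cut_le (l : seq rtype) : exists z p t q : nat,
  [/\ (size l = z + (z + p) + (t + (t + q)))%N,
      forall b, (count (fun r => r.1 != b) l + count (fun r => r.2 != b) l
                 <= size l + p)%N &
      (let m := (size l)%:Z in let x := (z + p)%:Z in
      (4 * row_cut l)%:Z <= 3 * m ^+ 2 - 2 * m + 2 * x * (m + 2) - 3 * x ^+ 2
        - (q%:Z - z%:Z) ^+ 2 - 2 * p%:Z ^+ 2 - 2 * p%:Z)%R].
Proof.
have := row_cutE l; have := walk_area_le l.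
have /= := count_row predT l; rewrite count_predT.
move: (row_cut l) (walk_area l) (size l) (count_row^~ l).
move: (count_mem rSS l) (count_mem rTS l) (count_mem rTT l) (count_mem rST l).
move=> x y z t c D m countE /= ->.
rewrite !mul1n => leD eqc.
exists (minn x z), (maxn x z - minn x z)%N, (minn y t), (maxn y t - minn y t)%N.
split; first by lia.
  (* For b = S the left side is y + 2 z + t = m + z - x; for b = T it is m + x - z. *)
  by case; rewrite !countE /=; lia.
move: leD eqc; case: (leqP x z) => [|/ltnW] /subnKC <-;
  case: (leqP y t) => [|/ltnW] /subnKC <-; rewrite ?addKn.
all: by move: (_ - _)%N (_ - _)%N => p q leD eqc; lia.
Qed.

(** * Candidate blocks and integer optimization *)

Definition blocks (x y z : nat) : seq rtype := nseq z rTT ++ nseq y rTS ++ nseq x rSS.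

Lemma size_blocks x y z : size (blocks x y z) = (x + y + z)%N.
Proof. by rewrite !size_cat !size_nseq; lia. Qed.

(** With t = 0 the bound of [walk_area_le] is (x + z) y, and this walk attains it. *)
Lemma row_cut_blocks (x y z : nat) :
  ((4 * row_cut (blocks x y z))%:Z =
   3 * (x + y + z)%:Z ^+ 2 - (x + y + z)%:Z + 2 * ((x + z) * y)%:Z
   + (x + z)%:Z - y%:Z - 3 * (x%:Z - z%:Z) ^+ 2 - y%:Z ^+ 2)%R.
Proof.
have area_x : walk_area (nseq x rSS) = 0%R.
  by elim: x => //= x ->; rewrite !count_nseq /=; lia.
have area_xy : walk_area (nseq y rTS ++ nseq x rSS) = (x * y)%N%:Z%R.
  by elim: y => [|y IH] /=; rewrite ?area_x ?IH ?count_cat ?count_nseq /=; lia.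
have area_xyz : walk_area (blocks x y z) = ((x + z) * y)%N%:Z%R.
  by elim: z => [|z IH] /=; rewrite /blocks /= ?area_xy ?IH ?count_cat ?count_nseq /=; lia.
rewrite row_cutE area_xyz /blocks !count_cat !count_nseq /=.
by rewrite ?mul0n ?mul1n ?addn0 ?add0n; lia.
Qed.

(** The estimates of the theorem, scaled by 3 and 6 to stay integral; 60 = 6 * 10 corresponds to C =
    10. *)
Definition near_opt (k x y z c : nat) : Prop :=
  [/\ (`|(3 * x)%:Z - k%:Z| <= 3)%R, (`|(3 * y)%:Z - k%:Z| <= 3)%R,
      (`|(3 * z)%:Z - k%:Z| <= 3)%R
    & (`|(6 * c)%:Z - 5 * k%:Z ^+ 2| <= 60 * k%:Z)%R].

(* Substitutes [z + p = r + d] and [u = q - z] in [row_cut_le]. *)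
Lemma row_cut_le_loss (r e : nat) (l : seq rtype) : size l = (3 * r + e)%N ->
  exists d p u t : int,
  (0 <= p /\ 0 <= t /\ u + 2 * t = e%:Z - 3 * d + 2 * p /\
   (forall b, (count (fun q => q.1 != b) l + count (fun q => q.2 != b) l)%:Z
              <= (3 * r + e)%:Z + p) /\
   (4 * row_cut l)%:Z + (3 * d ^+ 2 - 2 * d * (e%:Z + 2) + u ^+ 2 + 2 * p ^+ 2 + 2 * p)
     <= 30 * r%:Z ^+ 2 + 20 * r%:Z * e%:Z - 2 * r%:Z + 3 * e%:Z ^+ 2 - 2 * e%:Z)%R.
Proof.
move=> el; have [z [p [t [q [em le_count le_cut]]]]] := row_cut_le l.
exists (z%:Z + p%:Z - r%:Z)%R, p%:Z%R, (q%:Z - z%:Z)%R, t%:Z%R.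
move: em le_count le_cut; rewrite el => em le_count le_cut.
split; first by []; split; first by []; split; first by lia.
split; first by move=> b; have := le_count b; lia.
by move: le_cut => /=; lia.
Qed.

(** As t >= 0, u is at most e - 3 d + 2 p and has the parity of e - 3 d; quadratic growth leaves
    only small d and p to compare. The lists hold the minima for e = 0, 1, 2, and 4 p bounds the
    extra gain from $v_k$. *)
Lemma loss_ge (e : nat) (d p u t : int) : (e < 3)%N ->
  (0 <= p -> 0 <= t -> u + 2 * t = e%:Z - 3 * d + 2 * p ->
   let loss := 3 * d ^+ 2 - 2 * d * (e%:Z + 2) + u ^+ 2 + 2 * p ^+ 2 + 2 * p in
   [:: 0; 1; - 4]`_e <= loss /\ [:: 0; - 3; - 4]`_e <= loss - 4 * p)%R.
Proof.
move=> e_lt3 p_ge0 t_ge0 eu.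
have d_cases : (d <= -1 \/ d = 0 \/ d = 1 \/ d = 2 \/ 3 <= d)%R by lia.
have p_cases : (p = 0 \/ p = 1 \/ 2 <= p)%R by lia.
have sqr_ge0 : (0 <= u ^+ 2)%R by exact: sqr_ge0.
have sqr_ge1 : (u <> 0 -> 1 <= u ^+ 2)%R by nia.
have sqr_ge9 : (u <= -3 -> 9 <= u ^+ 2)%R by nia.
case: e e_lt3 eu => [|[|[|//]]] _ /= eu;
case: d_cases => [?|[?|[?|[?|?]]]]; case: p_cases => [?|[?|?]]; subst; split; nia.
Qed.

(** There are k + 1 rows but the lengths are compared with k / 3, so residues are those of k + 1. *)
Lemma row_cut_opt (k : nat) : (0 < k)%N -> exists x y z : nat,
  [/\ size (blocks x y z) = k.+1, near_opt k x y z (row_cut (blocks x y z))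
    & forall l, size l = k.+1 -> (row_cut l <= row_cut (blocks x y z))%N].
Proof.
move=> k_gt0; pose r := (k.+1 %/ 3)%N; pose e := (k.+1 %% 3)%N.
have e_lt3 : (e < 3)%N by rewrite ltn_mod.
have ek : k.+1 = (3 * r + e)%N by rewrite mulnC -divn_eq.
have le_cut l : size l = (3 * r + e)%N ->
  ((4 * row_cut l)%:Z + [:: 0; 1; - 4]`_e
     <= 30 * r%:Z ^+ 2 + 20 * r%:Z * e%:Z - 2 * r%:Z + 3 * e%:Z ^+ 2 - 2 * e%:Z)%R.
  move=> /row_cut_le_loss [d [p [u [t [p_ge0 [t_ge0 [eu [_ le]]]]]]]].
  have [+ _] := loss_ge e_lt3 p_ge0 t_ge0 eu; move: (nth _ _ _) => c; lia.
move: ek le_cut; rewrite {}/r; move: (_ %/ _)%N e e_lt3 => r e + ek.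
rewrite ek.
case: e ek => [|[|[|//]]] ek _ /= le_cut.
(* The three witnesses have p = t = 0 and (d, u) = (0, 0), (0, 1), (1, -1), where the loss is
   minimal. *)
- exists r, r, r; rewrite size_blocks; have := row_cut_blocks r r r.
  move: (row_cut (blocks r r r)) => c ec; split; first by lia.
    by split; nia.
  by move=> l /le_cut; lia.
- exists r, r.+1, r; rewrite size_blocks; have := row_cut_blocks r r.+1 r.
  move: (row_cut (blocks r r.+1 r)) => c ec; split; first by lia.
    by split; nia.
  by move=> l /le_cut; lia.
- exists r.+1, r, r.+1; rewrite size_blocks; have := row_cut_blocks r.+1 r r.+1.
  move: (row_cut (blocks r.+1 r r.+1)) => c ec; split; first by lia.
    by split; nia.
  by move=> l /le_cut; lia.
Qed.

(** In $CC_k^-$ the vertex $v_k$ is adjacent to every other vertex. *)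
Lemma row_cut_minusE (r : rtype) (l : seq rtype) : row_cut_minus r l =
  (row_cut l + (count (fun q => q.1 != r.1) l + count (fun q => q.2 != r.1) l))%N.
Proof.
rewrite /row_cut_minus /row_cut /clique_cut /= (count_row fst).
move: (chain_cut l) (count_row^~ l).
move: (count_mem rSS l) (count_mem rTS l) (count_mem rTT l) (count_mem rST l).
move=> x y z t c countE; rewrite !countE.
by case: r => -[] b /=; lia.
Qed.

Lemma row_cut_minus_opt (k : nat) (b : bool) : (0 < k)%N -> exists x y z : nat,
  [/\ size (blocks x y z) = k,
      near_opt k x y z (row_cut_minus (false, b) (blocks x y z))
    & forall r l, size l = k ->
      (row_cut_minus r l <= row_cut_minus (false, b) (blocks x y z))%N].
Proof.
move=> k_gt0; pose r := (k %/ 3)%N; pose e := (k %% 3)%N.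
have e_lt3 : (e < 3)%N by rewrite ltn_mod.
have ek : k = (3 * r + e)%N by rewrite mulnC -divn_eq.
have le_cut q l : size l = (3 * r + e)%N ->
  ((4 * row_cut_minus q l)%:Z + [:: 0; - 3; - 4]`_e
     <= 30 * r%:Z ^+ 2 + 20 * r%:Z * e%:Z - 2 * r%:Z + 3 * e%:Z ^+ 2 - 2 * e%:Z
       + 4 * (3 * r + e)%:Z)%R.
  move=> /row_cut_le_loss [d [p [u [t [p_ge0 [t_ge0 [eu [/(_ q.1) + le]]]]]]]].
  have [_ +] := loss_ge e_lt3 p_ge0 t_ge0 eu; rewrite row_cut_minusE.
  by move: (nth _ _ _) => c; lia.
(* In T, $v_k$ is cut from x vertices $v_i$ and x + y vertices $v'_j$; the sum is m + x - z. *)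
have cut_blocks x y z : row_cut_minus (false, b) (blocks x y z) =
  (row_cut (blocks x y z) + (2 * x + y))%N.
  by rewrite row_cut_minusE /blocks !count_cat !count_nseq /=; lia.
move: ek le_cut; rewrite {}/r; move: (_ %/ _)%N e e_lt3 => r e + ek.
rewrite ek.
case: e ek => [|[|[|//]]] ek _ /= le_cut.
(* Only e = 1 departs from the case of $CC_k$: there p = d = 1, u = 0, as the gain 4 p outweighs the
   loss. *)
- exists r, r, r; rewrite size_blocks cut_blocks; have := row_cut_blocks r r r.
  move: (row_cut (blocks r r r)) => c ec; split; first by lia.
    by split; nia.
  by move=> q l /(le_cut q); lia.
- exists r.+1, r, r; rewrite size_blocks cut_blocks; have := row_cut_blocks r.+1 r r.
  move: (row_cut (blocks r.+1 r r)) => c ec; split; first by lia.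
    by split; nia.
  by move=> q l /(le_cut q); lia.
- exists r.+1, r, r.+1; rewrite size_blocks cut_blocks; have := row_cut_blocks r.+1 r r.+1.
  move: (row_cut (blocks r.+1 r r.+1)) => c ec; split; first by lia.
    by split; nia.
  by move=> q l /(le_cut q); lia.
Qed.

(** * From edge cuts of the graphs to lists of row types *)

(** Each cut edge has a unique orientation leaving S. *)
Lemma cs_sum (T : finType) (G : sgraph T) (S : {set T}) :
  cs G S = \sum_u \sum_w [&& adj G u w, u \in S & w \notin S].
Proof.
pose D := [set p : T * T | [&& adj G p.1 p.2, p.1 \in S & p.2 \notin S]].
have card_edge u w : u != w -> #|[set u; w] :&: S| = (u \in S) + (w \in S).
  move=> uw; rewrite -sum1_card (eq_bigl (fun x => (x \in [set u; w]) && (x \in S))); last first.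
    by move=> x; rewrite in_setI.
  by rewrite big_mkcondr big_setU1 ?inE //= big_set1; do 2!case: ifP.
have -> : cs G S = #|[set [set p.1; p.2] | p in D]|.
  apply: eq_card => e; rewrite !inE; apply/andP/imsetP.
    case=> /imsetP[[u w] /= uw ->]; rewrite inE /= in uw.
    have neq : u != w by apply: contraTneq uw => ->; rewrite adj_irrefl.
    rewrite card_edge //; case uS: (u \in S); case wS: (w \in S) => // _.
      by exists (u, w); rewrite ?inE /= ?uw ?uS ?wS.
    by exists (w, u); rewrite ?inE /= 1?adj_sym ?uw ?uS ?wS // setUC.
  case=> -[u w]; rewrite inE /= => /and3P[uw uS wS] ->.
  have neq : u != w by apply: contraTneq uw => ->; rewrite adj_irrefl.
  rewrite card_edge // uS (negbTE wS); split=> //.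
  by apply/imsetP; exists (u, w); rewrite ?inE.
rewrite card_in_imset.
  rewrite -sum1_card big_mkcond.
  rewrite (eq_bigr (fun p =>
    nat_of_bool [&& adj G p.1 p.2, p.1 \in S & p.2 \notin S])).
    by rewrite -(pair_bigA _ (fun u w => nat_of_bool [&& adj G u w, u \in S & w \notin S])).
  by move=> p _; rewrite inE; case: ifP.
move=> [u w] [u' w']; rewrite !inE /= => /and3P[_ uS wS] /and3P[_ uS' wS'] eq_e.
have : u \in [set u'; w'] by rewrite -eq_e !inE eqxx.
have : w \in [set u'; w'] by rewrite -eq_e !inE eqxx orbT.
rewrite !inE => /orP[/eqP ww|/eqP ->]; first by rewrite ww uS' in wS.
by case/orP => /eqP uu; [rewrite uu|rewrite uu (negbTE wS') in uS].
Qed.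

Lemma count_mkseq (T : Type) (p : pred T) (f : nat -> T) (n : nat) :
  count p (mkseq f n) = \sum_(i < n) p (f i).
Proof.
elim: n => [|n IH]; first by rewrite big_ord0.
by rewrite big_ord_recr mkseqS -cats1 count_cat IH /= addn0.
Qed.

Lemma clique_cut_sum (p : pred rtype) (f : nat -> rtype) (n : nat) :
  clique_cut p (rev (mkseq f n)) =
    \sum_(i < n) \sum_(j < n) (p (f i) && ~~ p (f j)).
Proof.
rewrite /clique_cut !count_rev !count_mkseq big_distrl; apply: eq_bigr => i _.
by rewrite big_distrr; apply: eq_bigr => j _ /=; rewrite mulnb.
Qed.

Lemma chain_cut_sum (f : nat -> rtype) (n : nat) :
  chain_cut (rev (mkseq f n)) =
    \sum_(i < n) \sum_(j < n) ((j < i) && ((f j).2 != (f i).1)).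
Proof.
have -> : \sum_(i < n) \sum_(j < n) ((j < i) && ((f j).2 != (f i).1)) =
          \sum_(i < n) \sum_(j < i) ((f j).2 != (f i).1).
  apply: eq_bigr => i _.
  rewrite (big_ord_widen _ (fun j => nat_of_bool ((f j).2 != (f i).1)) (ltnW (ltn_ord i))).
  by rewrite [RHS]big_mkcond; apply: eq_bigr => j _; case: (j < i).
elim: n => [|n IH]; first by rewrite big_ord0.
by rewrite big_ord_recr mkseqS rev_rcons /= IH count_rev count_mkseq.
Qed.

(** Matches the three summands of [row_cut]; both orientations of a cross edge share one term. *)
Lemma sum2_sumType (A B : finType) (F : A + B -> A + B -> nat) :
  \sum_u \sum_w F u w =
    \sum_i \sum_j F (inl i) (inl j) + \sum_i \sum_j F (inr i) (inr j)
    + \sum_i \sum_j (F (inl i) (inr j) + F (inr j) (inl i)).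
Proof.
rewrite big_sumType /=.
under eq_bigr do rewrite big_sumType /=.
under [X in _ + X]eq_bigr do rewrite big_sumType /=.
under [X in _ = _ + X]eq_bigr do rewrite big_split /=.
by rewrite !big_split /= [X in _ = _ + (_ + X)]exchange_big /=; lia.
Qed.

Definition row_of (k : nat) (S : {set cc_vertex k}) (i : nat) : rtype :=
  row_type S (inord i).

Lemma cs_CC (k : nat) (S : {set cc_vertex k}) :
  cs (CC k) S = row_cut (rev (mkseq (row_of S) k.+1)).
Proof.
rewrite cs_sum /row_cut !clique_cut_sum chain_cut_sum sum2_sumType.
congr (_ + _ + _); apply: eq_bigr => i _; apply: eq_bigr => j _;
  rewrite /row_of !inord_val /= /v /v'.
- by case: eqP => // ->; rewrite andbN.
- by case: eqP => // ->; rewrite andbN.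
- by case: (j < i) => //=; do 2!case: (_ \in S).
Qed.

(* The partner of [v_k] is absent from the graph: only the first component of
   [row_of S k] matters in [row_cut_minus]. *)
Lemma cs_CC_minus (k : nat) (S : {set cc_vertex k}) : v' ord_max \notin S ->
  cs (CC_minus k) S = row_cut_minus (row_of S k) (rev (mkseq (row_of S) k)).
Proof.
(* With the row of $v_k$ absorbed, the first clique and the chain part range over k + 1 rows, the
   second clique over k. *)
move=> kS; rewrite cs_sum /row_cut_minus -!rev_rcons -!mkseqS.
rewrite !clique_cut_sum chain_cut_sum sum2_sumType.
congr (_ + _ + _); last 1 first.
- apply: eq_bigr => i _; apply: eq_bigr => j _.
  rewrite /row_of !inord_val /= /del_adj /= /v' !eqE /= !andbT.
  case: ltnP => //= ji; have -> : j != ord_max by rewrite -val_eqE /=; have := ltn_ord i; lia.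
  by do 2!case: (_ \in S).
- apply: eq_bigr => i _; apply: eq_bigr => j _.
  rewrite /row_of !inord_val /= /del_adj /= !andbT.
  by case: eqP => // ->; rewrite andbN.
(* The deleted $v'_k$ has no edges, so its terms vanish from the second clique. *)
rewrite big_ord_recr /= [X in _ + X]big1 ?addn0 => [|j _]; last first.
  by rewrite /del_adj eqxx /= andbF.
apply: eq_bigr => i _; rewrite big_ord_recr /= /del_adj eqxx !andbF addn0.
apply: eq_bigr => j _.
have wE (h : 'I_k) : inord h = widen_ord (leqnSn k) h :> 'I_k.+1.
  by apply: val_inj; rewrite /= inordK // ltnW ?ltnS.
have wN (h : 'I_k) : (inr (widen_ord (leqnSn k) h) != v' ord_max :> cc_vertex k).
  by rewrite /v' (inj_eq inr_inj) -val_eqE /= neq_ltn ltn_ord.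
rewrite !wN /row_of !wE /= /v' !andbT.
by case: eqP => // ->; rewrite andbN.
Qed.

(** * Cuts realizing a prescribed sequence of rows *)

Definition set_of (k : nat) (f : nat -> rtype) : {set cc_vertex k} :=
  [set u | match u : 'I_k.+1 + 'I_k.+1 with inl i => (f i).1 | inr i => (f i).2 end].

Lemma row_of_set_of (k : nat) (f : nat -> rtype) (i : nat) : i < k.+1 ->
  row_of (set_of k f) i = f i.
Proof. by move=> ik; rewrite /row_of /row_type !inE /= inordK //; case: (f i). Qed.

Lemma map_row_type (k n : nat) (S : {set cc_vertex k}) : n <= k.+1 ->
  [seq row_type S i | i <- [seq i : 'I_k.+1 <- enum 'I_k.+1 | i < n]] = mkseq (row_of S) n.
Proof.
move=> nk; rewrite /mkseq.
have -> : [seq row_type S i | i <- [seq i : 'I_k.+1 <- enum 'I_k.+1 | i < n]] =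
          map (row_of S) (map val [seq i : 'I_k.+1 <- enum 'I_k.+1 | i < n]).
  by rewrite -map_comp; apply: eq_map => i /=; rewrite /row_of inord_val.
congr map; rewrite -(filter_map _ (fun i => i < n)) val_enum_ord.
rewrite -(subnKC nk) iotaD filter_cat add0n.
rewrite (eq_in_filter (a2 := predT)) ?filter_predT => [|i]; last by rewrite mem_iota.
rewrite (eq_in_filter (a2 := pred0)) ?filter_pred0 ?cats0 // => i.
by rewrite mem_iota [i < n]ltnNge => /andP[-> _].
Qed.

Lemma rows_CC (k : nat) : rows (CC k) = [seq i : 'I_k.+1 <- enum 'I_k.+1 | i < k.+1].
Proof. by apply: eq_filter => i; rewrite !inE ltn_ord. Qed.

Lemma rows_CC_minus (k : nat) : rows (CC_minus k) = [seq i : 'I_k.+1 <- enum 'I_k.+1 | i < k].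
Proof.
apply: eq_filter => i; rewrite !inE /= !andbT /v' (inj_eq inr_inj) -val_eqE /=.
by have := ltn_ord i; lia.
Qed.

Lemma near_opt_rat (k x y z c : nat) : near_opt k x y z c ->
  (exists dx dy dz : rat,
     x%:R = k%:R / 3%:R + dx /\ y%:R = k%:R / 3%:R + dy /\ z%:R = k%:R / 3%:R + dz /\
     `|dx| <= 1 /\ `|dy| <= 1 /\ `|dz| <= 1)%R /\
  (`|c%:R - 5%:R / 6%:R * k%:R ^+ 2 : rat| <= 10%:R * k%:R)%R.
Proof.
have near n : (`|(3 * n)%:Z - k%:Z| <= 3 -> `|n%:R - k%:R / 3%:R : rat| <= 1)%R.
  move=> nk; rewrite ler_norml; apply/andP; split.
    have : ((k%:R : rat) <= (3 * n + 3)%:R)%R by rewrite ler_nat; lia.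
    by rewrite natrD natrM; lra.
  have : (((3 * n)%:R : rat) <= (k + 3)%:R)%R by rewrite ler_nat; lia.
  by rewrite natrD natrM; lra.
case=> /near xk /near yk /near zk ck; split.
  exists (x%:R - k%:R / 3%:R)%R, (y%:R - k%:R / 3%:R)%R, (z%:R - k%:R / 3%:R)%R.
  by rewrite !subrKC.
rewrite ler_norml; apply/andP; split.
  have : ((5 * k ^ 2)%:R <= (6 * c + 60 * k)%:R :> rat)%R by rewrite ler_nat; lia.
  by rewrite natrD !natrM; lra.
have : ((6 * c)%:R <= (5 * k ^ 2 + 60 * k)%:R :> rat)%R by rewrite ler_nat; lia.
by rewrite natrD !natrM; lra.
Qed.

Local Open Scope ring_scope.

Theorem theorem2 :
  exists C : rat,
    forall (k : nat) (G : sgraph (cc_vertex k)),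
      (1 <= k)%N ->
      G = CC k \/ G = CC_minus k ->
      exists S : {set cc_vertex k},
        is_max_cut G S /\
        (exists (x y z t : nat) (dx dy dz : rat),
           block_pattern G S x y z t /\
           x%:R = k%:R / 3%:R + dx /\
           y%:R = k%:R / 3%:R + dy /\
           z%:R = k%:R / 3%:R + dz /\
           t = 0%N /\
           `|dx| <= 1 /\ `|dy| <= 1 /\ `|dz| <= 1) /\
        `|(cs G S)%:R - 5%:R / 6%:R * k%:R ^+ 2| <= C * k%:R.
Proof.
exists 10%:R => k G k_gt0.
(* For $CC_k^-$ the default is the value at index k: it puts $v_k$ in T and keeps the deleted $v'_k$
   out of the cut. *)
pose f x y z := nth (false, false) (rev (blocks x y z)).
have mkseq_f n x y z : size (blocks x y z) = n ->
    mkseq (f x y z) n = rev (blocks x y z).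
  by move=> <-; rewrite -(size_rev (blocks x y z)) mkseq_nth.
have mkseq_set_of n x y z : (n <= k.+1)%N -> size (blocks x y z) = n ->
    mkseq (row_of (set_of k (f x y z))) n = rev (blocks x y z).
  move=> nk sz; rewrite -(mkseq_f n) //; apply/eq_in_map => i.
  by rewrite mem_iota => /andP[_ i_lt]; apply: row_of_set_of; apply: leq_trans nk.
have blocksE x y z : rev (blocks x y z) =
    nseq x rSS ++ nseq y rTS ++ nseq z rTT ++ nseq 0 rST.
  by rewrite /blocks !rev_cat !rev_nseq cats0 catA.
case=> ->.
  have [x [y [z [sz /near_opt_rat[[dx [dy [dz near]]] near_cs] opt]]]] := row_cut_opt k_gt0.
  have csE : cs (CC k) (set_of k (f x y z)) = row_cut (blocks x y z).
    by rewrite cs_CC mkseq_set_of // revK.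
  exists (set_of k (f x y z)); rewrite csE; split; last split=> //.
    split; first by apply/subsetP => u _; rewrite inE.
    by move=> S _; rewrite csE cs_CC opt // size_rev size_mkseq.
  exists x, y, z, 0%N, dx, dy, dz; split; last by intuition.
  by rewrite /block_pattern rows_CC map_row_type // mkseq_set_of // blocksE.
have [x [y [z [sz /near_opt_rat[[dx [dy [dz near]]] near_cs] opt]]]] :=
  row_cut_minus_opt false k_gt0.
have fk : f x y z k = (false, false) by rewrite /f nth_default // size_rev sz.
have v'k : v' ord_max \notin set_of k (f x y z) by rewrite inE /= fk.
have csE : cs (CC_minus k) (set_of k (f x y z)) =
    row_cut_minus (false, false) (blocks x y z).
  by rewrite cs_CC_minus // mkseq_set_of // row_of_set_of // fk revK.
exists (set_of k (f x y z)); rewrite csE; split; last split=> //.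
  split.
    apply/subsetP => u uS; rewrite !inE andbT.
    by apply: contraNneq v'k => <-.
  move=> S /subsetP S_sub; rewrite csE cs_CC_minus ?opt // ?size_rev ?size_mkseq //.
  by apply/negP => /S_sub; rewrite !inE eqxx.
exists x, y, z, 0%N, dx, dy, dz; split; last by intuition.
by rewrite /block_pattern rows_CC_minus map_row_type // mkseq_set_of // blocksE.
Qed.
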